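(* Let $\mathcal{T}\in\mathbb{R}^{m_1\times\cdots\times m_M}$ be a tensor given as a tensor network, and let $\mathcal{G}\in\mathbb{R}^{n_1\times\cdots\times n_N}$ be a core tensor appearing only once in the tensor network (i.e. $\mathcal{G}$ is the tensor carried by exactly one vertex, and the tensors carried by the other vertices do not depend on $\mathcal{G}$). Regard $\mathcal{T}$ as a function of $\mathcal{G}$. Then the Jacobian tensor $\frac{\partial \mathcal{T}}{\partial \mathcal{G}}\in\mathbb{R}^{m_1\times\cdots\times m_M\times n_1\times\cdots\times n_N}$ is the tensor obtained by removing $\mathcal{G}$ from the tensor network of $\mathcal{T}$.
   Context: Tensor network: a finite set $V$ of vertices, each vertex $v$ carrying a real tensor (called a core tensor) whose modes are called the legs of $v$. Some of the legs (of all vertices taken together) are matched in pairs of equal dimension; each matched pair is an edge (parallel edges and loops are allowed). The unmatched legs are the dangling legs, numbered $1,\dots,M$, with dimensions $m_1,\dots,m_M$. The tensor $\mathcal{T}$ represented by the network has entry $\mathcal{T}_{i_1,\dots,i_M}$ equal to the sum, over all assignments of an index $r_e$ (ranging over the dimension of $e$) to each edge $e$, of the product over the vertices $v$ of the entry of the tensor at $v$ at the indices carried by its legs (index $r_e$ on a leg belonging to edge $e$, index $i_k$ on the $k$-th dangling leg). Jacobian tensor: for $f:\mathbb{R}^{n_1\times\cdots\times n_N}\to\mathbb{R}^{m_1\times\cdots\times m_M}$, $\frac{\partial f(\theta)}{\partial\theta}\in\mathbb{R}^{m_1\times\cdots\times m_M\times n_1\times\cdots\times n_N}$ has entries $\left(\frac{\partial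 f(\theta)}{\partial \theta}\right)_{i_1,\dots,i_M,j_1,\dots,j_N}=\frac{\partial f(\theta)_{i_1,\dots,i_M}}{\partial\theta_{j_1,\dots,j_N}}$. Removing a core: removing the node $v_0$ carrying $\mathcal{G}$ deletes only the node and leaves all of its legs in place, their freed ends becoming the new dangling legs indexed by $j_1,\dots,j_N$ (the modes of $\mathcal{G}$). Explicitly, the entry at $(i_1,\dots,i_M,j_1,\dots,j_N)$ of the resulting tensor is $$\sum \ \prod_{v\neq v_0}(\text{entry of the tensor at }v)\ \cdot\prod_{(k,l)}\delta_{i_k j_l}\ \cdot\prod_{\{l,l'\}}\delta_{j_l j_{l'}},$$ where the sum is over assignments of indices to the edges not incident to $v_0$; a leg of a vertex $v\neq v_0$ that was joined to the $l$-th mode of $\mathcal{G}$ carries the index $j_l$; the product over $(k,l)$ runs over the pairs such that the $k$-th dangling leg of the network is the $l$-th mode of $\mathcal{G}$; and the product over $\{l,l'\}$ runs over loops at $v_0$ joining modes $l$ and $l'$ of $\mathcal{G}$. Here $\delta$ is the Kronecker delta (an edge with no node is an identity matrix). *)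

(* Defs.v *)
From HB Require Import structures.
From mathcomp Require Import all_boot all_order all_algebra.
From mathcomp Require Import all_classical all_reals all_analysis.
Import numFieldNormedType.Exports.

Set Implicit Arguments.
Unset Strict Implicit.
Unset Printing Implicit Defensive.

Import Order.TTheory GRing.Theory Num.Theory.
Local Open Scope ring_scope.

(* A tensor of shape [d] has one mode for each [x : I], of dimension [d x]. *)
Definition multi_index (I : finType) (d : I -> nat) : finType :=
  {dffun forall x : I, 'I_(d x)}.

Definition tensor (R : Type) (I : finType) (d : I -> nat) : Type :=
  {ffun multi_index d -> R}.

Definition kronecker (R : pzRingType) (a b : nat) : R := (a == b)%:R.

Section Jacobian.
Variables (R : realType) (I J : finType) (m : I -> nat) (n : J -> nat).

(* The modes of the codomain, followed by the modes of the domain. *)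
Definition sum_shape (x : I + J) : nat :=
  match x with inl k => m k | inr l => n l end.

Definition left_index (a : multi_index sum_shape) : multi_index m :=
  [ffun k => a (inl k)].

Definition right_index (a : multi_index sum_shape) : multi_index n :=
  [ffun l => a (inr l)].

Definition set_entry (theta : tensor R n) (j : multi_index n) (t : R) :
  tensor R n := [ffun a => if a == j then t else theta a].

Variable f : tensor R n -> tensor R m.

Definition has_partial (theta : tensor R n)
    (i : multi_index m) (j : multi_index n) : Prop :=
  derivable (fun t : R => f (set_entry theta j t) i) (theta j) 1.

Definition partial (theta : tensor R n)
    (i : multi_index m) (j : multi_index n) : R :=
  derive1 (fun t : R => f (set_entry theta j t) i) (theta j).

Definition jacobian_tensor (theta : tensor R n) : tensor R sum_shape :=
  [ffun a => partial theta (left_index a) (right_index a)].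

End Jacobian.

Definition plug_dim (E D : Type) (edim : E -> nat) (ddim : D -> nat)
    (w : E + D) : nat :=
  match w with inl e => edim e | inr k => ddim k end.

(* The combinatorial part of a tensor network, without the core tensors.
   The legs of a vertex [v] are the modes ['I_(arity v)] of its core.  Every leg
   is plugged either into an edge or into one of the numbered dangling ends;
   each edge receives exactly two legs (of the same vertex for a loop) and each
   dangling end exactly one. *)
Record network := Network {
  vertex : finType;
  arity : vertex -> nat;
  leg_dim : forall v : vertex, 'I_(arity v) -> nat;
  edge : finType;
  edim : edge -> nat;
  dangling : nat;
  ddim : 'I_dangling -> nat;
  plug : forall v : vertex, 'I_(arity v) -> edge + 'I_dangling;
  leg_dim_plug : forall (v : vertex) (l : 'I_(arity v)),
    leg_dim l = plug_dim edim ddim (plug l);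
  edge_legs : forall e : edge,
    #|[set x : {v : vertex & 'I_(arity v)} | plug (tagged x) == inl e]| = 2%N;
  dangling_legs : forall k : 'I_dangling,
    #|[set x : {v : vertex & 'I_(arity v)} | plug (tagged x) == inr k]| = 1%N
}.

Definition core_shape (S : network) (v : vertex S) : 'I_(arity v) -> nat :=
  @leg_dim S v.
Arguments core_shape {S} v l.

Definition out_shape (S : network) : 'I_(dangling S) -> nat := @ddim S.
Arguments out_shape S k : clear implicits.

Section Network.
Variables (R : realType) (S : network).

Definition plug_index
    (r : forall e : edge S, 'I_(edim e)) (i : multi_index (out_shape S))
    (w : edge S + 'I_(dangling S)) : 'I_(plug_dim (@edim S) (@ddim S) w) :=
  match w with inl e => r e | inr k => i k end.

Definition core_index
    (r : forall e : edge S, 'I_(edim e)) (i : multi_index (out_shape S))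
    (v : vertex S) : multi_index (core_shape v) :=
  [ffun l => cast_ord (esym (leg_dim_plug l)) (plug_index r i (plug l))].

Definition network_tensor (A : forall v : vertex S, tensor R (core_shape v)) :
  tensor R (out_shape S) :=
  [ffun i => \sum_(r : {dffun forall e : edge S, 'I_(edim e)})
               \prod_(v : vertex S) A v (core_index r i v)].

Definition replace_core (A : forall v : vertex S, tensor R (core_shape v))
    (v0 : vertex S) (X : tensor R (core_shape v0)) :
  forall v : vertex S, tensor R (core_shape v) := eqtype.dfwith A X.

Section Removal.
Variable v0 : vertex S.

Definition incident (e : edge S) : bool :=
  [exists l : 'I_(arity v0), plug l == inl e].

Lemma not_incident (e : edge S) :
  (fun l : 'I_(arity v0) => plug l == inl e) =1 xpred0 -> ~~ incident e.
Proof. by move=> h; apply/existsPn => l; rewrite h. Qed.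

Lemma dim_incident (e : edge S) (l : 'I_(arity v0)) :
  plug l == inl e -> leg_dim l = edim e.
Proof. by move=> /eqP h; rewrite leg_dim_plug h. Qed.

(* An edge between [v0] and another vertex has a unique mode [l] at [v0], and
   carries [j l].  The value given to a loop at [v0] is never used, as loops
   have no leg at another vertex; they are accounted for in [remove_core]. *)
Definition freed_index
    (r : forall e : {e : edge S | ~~ incident e}, 'I_(edim (val e)))
    (j : multi_index (core_shape v0)) (e : edge S) : 'I_(edim e) :=
  match pickP (fun l : 'I_(arity v0) => plug l == inl e) with
  | Pick l hl => cast_ord (dim_incident hl) (j l)
  | Nopick h => r (exist _ e (not_incident h))
  end.

(* The first Kronecker product is over the legs that are both dangling and a
   mode of the core of [v0]; the second is over the loops at [v0]. *)
Definition remove_core (A : forall v : vertex S, tensor R (core_shape v)) :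
  tensor R (sum_shape (out_shape S) (core_shape v0)) :=
  [ffun a =>
    let i := left_index a in
    let j := right_index a in
    \sum_(r : {dffun forall e : {e : edge S | ~~ incident e},
                 'I_(edim (val e))})
      ((\prod_(v : vertex S | v != v0)
          A v (core_index (freed_index r j) i v))
       * (\prod_(p : 'I_(dangling S) * 'I_(arity v0) | plug p.2 == inr p.1)
            kronecker R (i p.1) (j p.2))
       * (\prod_(p : 'I_(arity v0) * 'I_(arity v0) |
                   (p.1 < p.2)%N &&
                   [exists e : edge S,
                      (plug p.1 == inl e) && (plug p.2 == inl e)])
            kronecker R (j p.1) (j p.2)))].

End Removal.
End Network.

(* Main.v *)
Require Import Defs.
From mathcomp Require Import all_boot all_order all_algebra.
From mathcomp Require Import all_classical all_reals all_analysis.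
Import Order.TTheory GRing.Theory Num.Theory numFieldNormedType.Exports.
Local Open Scope ring_scope.

(* The network is linear in the core of [v0]: its partial derivative in entry
   [j] is the sum of the products of the other cores over those edge assignments
   [r] whose index at [v0] is [j]. Such an [r] is determined by its restriction
   to the edges not incident to [v0]. It extends a given restriction exactly when
   [j] agrees with [i] on the dangling modes of [v0] and is constant on its
   loops, which is what the Kronecker products express. *)

Lemma is_derive_affine (R : realType) (c d x : R) :
  is_derive x 1 (fun t : R => t * c + d) c.
Proof.
(* Instance search computes the derivative by the product rule; once the zero terms go, [c *: 1]
   remains, which is [c * 1] by conversion. *)
apply: is_derive_eq; rewrite scaler0 add0r addr0; exact: mulr1.
Qed.

Lemma prod_natr_bool (R : comPzRingType) (I : finType) (P Q : pred I) :
  \prod_(i | P i) (Q i)%:R = [forall (i | P i), Q i]%:R :> R.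
Proof.
rewrite -big_andE; elim/big_rec2: _ => // i b x _ ->.
by rewrite -natrM mulnb.
Qed.

Section CoreRemoval.
Variables (R : realType) (S : network).
Variables (A : forall v : vertex S, tensor R (core_shape v)) (v0 : vertex S).
Implicit Types (i : multi_index (out_shape S)) (j : multi_index (core_shape v0)).

Definition other_cores (r : forall e : edge S, 'I_(edim e)) i : R :=
  \prod_(v : vertex S | v != v0) A v (core_index r i v).

Lemma eq_core_index (r s : forall e : edge S, 'I_(edim e)) i v :
  (forall e, r e = s e) -> core_index r i v = core_index s i v.
Proof.
move=> rs; apply/ffunP => l; rewrite !ffunE; congr cast_ord.
by case: (plug l) => //=.
Qed.

(** Values are compared in [nat] because a leg and its edge or dangling end have dimensions that are
    only propositionally equal; this erases the casts. *)
Lemma core_indexP (r : forall e : edge S, 'I_(edim e)) i j :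
  reflect
    ((forall l e, plug l = inl e -> r e = j l :> nat) /\
     (forall l k, plug l = inr k -> i k = j l :> nat))
    (core_index r i v0 == j).
Proof.
apply: (iffP eqP) => [<-|[re ik]].
  by split=> l w lw; rewrite ffunE /=; case: _ / (esym lw).
apply/ffunP => l; rewrite ffunE; apply: val_inj => /=.
by case lw: (plug l) => [e|k] /=; [exact: re | exact: ik].
Qed.

Lemma network_tensor_replace_core (X : tensor R (core_shape v0)) i :
  network_tensor (replace_core A X) i =
  \sum_(r : {dffun forall e : edge S, 'I_(edim e)})
    X (core_index r i v0) * other_cores r i.
Proof.
rewrite ffunE; apply: eq_bigr => r _.
rewrite (bigD1 v0) //= /replace_core eqtype.dfwith_in; congr (_ * _).
by apply: eq_bigr => v vv0; rewrite eqtype.dfwith_out // eq_sym.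
Qed.

(** Each summand contains exactly one entry of the core at [v0], so [t] enters linearly, and only
    through the assignments that read entry [j]. *)
Lemma network_tensor_set_entry (G : tensor R (core_shape v0)) i j (t : R) :
  network_tensor (replace_core A (set_entry G j t)) i =
  t * (\sum_(r : {dffun forall e : edge S, 'I_(edim e)} |
             core_index r i v0 == j) other_cores r i) +
  \sum_(r : {dffun forall e : edge S, 'I_(edim e)} |
             core_index r i v0 != j) G (core_index r i v0) * other_cores r i.
Proof.
rewrite network_tensor_replace_core.
rewrite (bigID (fun r : {dffun _} => core_index r i v0 == j)) /=.
congr (_ + _); last first.
  by apply: eq_bigr => r /negbTE rj; rewrite ffunE rj.
by rewrite big_distrr; apply: eq_bigr => r rj; rewrite ffunE rj.
Qed.

(** A loop at [v0] has two modes and [pickP] may select the other one, hence an existential [l']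
    instead of [l] itself. *)
Lemma freed_index_incident
    (r : forall e : {e : edge S | ~~ incident v0 e}, 'I_(edim (val e)))
    j (e : edge S) (l : 'I_(arity v0)) :
  plug l = inl e ->
  exists2 l' : 'I_(arity v0), plug l' = inl e & freed_index r j e = j l' :> nat.
Proof.
move=> le; rewrite /freed_index; case: pickP => [l' l'e|h].
  by exists l' => //; apply/eqP.
by have := h l; rewrite le eqxx.
Qed.

Lemma freed_index_not_incident
    (r : forall e : {e : edge S | ~~ incident v0 e}, 'I_(edim (val e)))
    j (e : {e : edge S | ~~ incident v0 e}) :
  freed_index r j (val e) = r e.
Proof.
case: e => e he; rewrite /freed_index; case: pickP => [l le|h].
  by case/negP: (he); apply/existsP; exists l.
by rewrite (bool_irrelevance (not_incident h) he).
Qed.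

Lemma freed_index_restrict (r : forall e : edge S, 'I_(edim e)) i j e :
  core_index r i v0 = j ->
  freed_index (fun e : {e : edge S | ~~ incident v0 e} => r (val e)) j e = r e.
Proof.
move=> /eqP/core_indexP[re _]; rewrite /freed_index; case: pickP => // l le.
by apply: val_inj; rewrite /= (re _ _ (eqP le)).
Qed.

(** The extension by [freed_index] copies one mode of [j] onto each incident edge. A mismatch with
    [j] can thus occur only at a dangling mode or at the other end of a loop. *)
Lemma kronecker_core_index
    (r : forall e : {e : edge S | ~~ incident v0 e}, 'I_(edim (val e))) i j :
  (\prod_(p : 'I_(dangling S) * 'I_(arity v0) | plug p.2 == inr p.1)
     kronecker R (i p.1) (j p.2)) *
  (\prod_(p : 'I_(arity v0) * 'I_(arity v0) |
          (p.1 < p.2)%N &&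
          [exists e : edge S, (plug p.1 == inl e) && (plug p.2 == inl e)])
     kronecker R (j p.1) (j p.2)) =
  (core_index (freed_index r j) i v0 == j)%:R.
Proof.
rewrite /kronecker !prod_natr_bool -natrM mulnb; congr (nat_of_bool _)%:R.
apply/andP/core_indexP => [[/forall_inP ij /forall_inP jj]|[rj ij]]; split.
- move=> l e le; have [l' l'e ->] := freed_index_incident r j _ _ le.
  (* The product lists each loop once, with its smaller mode first; if [l] is the selected mode,
     nothing is left to compare. *)
  have [ll'|l'l|/val_inj->//] := ltngtP l l'.
    apply/esym/eqP; apply: (jj (l, l')); rewrite ll'; apply/existsP.
    by exists e; rewrite le l'e eqxx.
  apply/eqP; apply: (jj (l', l)); rewrite l'l; apply/existsP.
  by exists e; rewrite le l'e eqxx.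
- by move=> l k lk; apply/eqP; apply: (ij (k, l)); rewrite lk.
- by apply/forall_inP => -[k l] /eqP lk; apply/eqP/ij.
- apply/forall_inP => -[l l'] /andP[_ /existsP[e /andP[/eqP le /eqP l'e]]].
  by rewrite -(rj _ _ le) -(rj _ _ l'e).
Qed.

(** The right-hand side is the slope found in [network_tensor_set_entry]. *)
Lemma remove_coreE (a : multi_index (sum_shape (out_shape S) (core_shape v0))) :
  remove_core v0 A a =
  \sum_(r : {dffun forall e : edge S, 'I_(edim e)} |
        core_index r (left_index a) v0 == right_index a)
    other_cores r (left_index a).
Proof.
rewrite ffunE /=; set i := left_index a; set j := right_index a.
pose ext (r : {dffun forall e : {e : edge S | ~~ incident v0 e},
                 'I_(edim (val e))}) : {dffun forall e : edge S, 'I_(edim e)} :=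
  [ffun e => freed_index r j e].
pose restr (r : {dffun forall e : edge S, 'I_(edim e)}) :
    {dffun forall e : {e : edge S | ~~ incident v0 e}, 'I_(edim (val e))} :=
  [ffun e => r (val e)].
have extE r v : core_index (ext r) i v = core_index (freed_index r j) i v.
  by apply: eq_core_index => e; rewrite ffunE.
have extK r : restr (ext r) = r.
  by apply/ffunP => e; rewrite !ffunE freed_index_not_incident.
(* An assignment with index [j] at [v0] is recovered from its restriction, as [j] forces its values
   on incident edges. *)
rewrite (reindex_onto ext restr) /=; last first.
  move=> r /eqP rj; apply/ffunP => e; rewrite ffunE.
  rewrite -[RHS](freed_index_restrict _ _ _ e rj) /freed_index.
  by case: pickP => // h; rewrite ffunE.
(* Restrictions whose extension misses [j] remain in the sum on the left, where the Kronecker factor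
   annihilates them. *)
rewrite [RHS]big_mkcond; apply: eq_bigr => r _.
rewrite -mulrA (kronecker_core_index r) extE extK eqxx andbT.
case: eqP => _; rewrite ?mulr0 // mulr1.
by apply: eq_bigr => v _; rewrite extE.
Qed.

End CoreRemoval.

Theorem theorem19 (R : realType) (S : network)
    (A : forall v : vertex S, tensor R (core_shape v))
    (v0 : vertex S) (G : tensor R (core_shape v0)) :
  let T := fun X : tensor R (core_shape v0) =>
             network_tensor (replace_core A X) in
  (forall (i : multi_index (out_shape S)) (j : multi_index (core_shape v0)),
     has_partial T G i j) /\
  jacobian_tensor T G = remove_core v0 A.
Proof.
move=> T; split=> [i j|].
  rewrite /has_partial /T (funext (network_tensor_set_entry _ _ _ _ _ _ _)).
  by apply: ex_derive; exact: is_derive_affine.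
apply/ffunP => a; rewrite remove_coreE ffunE /partial /T.
rewrite (funext (network_tensor_set_entry _ _ _ _ _ _ _)) derive1E.
by apply: derive_val; exact: is_derive_affine.
Qed.
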